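(* Let $1\le n<m$ and let $f(X)=\sum_{i=0}^{n}a_{i}X^{i}$, $g(X)=\sum_{i=0}^{m}b_{i}X^{i}\in\mathbb{Z}[X]$ with $a_{0}a_{n}b_{0}b_{m}\neq 0$. Suppose that $|Res(f,g)|=pq$ with $p$ a prime number and $q$ a positive integer. Suppose also that for two positive real numbers $A,B$ with $B\geq A+q^{1/n}$ we have $|a_{n}|>\sum_{i=0}^{n-1}|a_{i}|A^{i-n}$ and $|b_{0}|\geq\sum_{i=1}^{m}|b_{i}|B^{i}$. Let $M$ and $N$ be integers, not both zero, satisfying the two inequalities $$|N|\leq\frac{B-A}{q^{1/n}}\quad\text{and}\quad |M|\leq|N|\cdot\frac{|b_{0}|-\sum_{i=1}^{m}|b_{i}|(A+q^{1/n}|N|)^{i}}{\sum_{i=0}^{n}|a_{i}|(A+q^{1/n}|N|)^{i}}.$$ Then the polynomial $Mf(X)+Ng(X)$ is irreducible over $\mathbb{Q}$. Moreover, the same conclusion holds if the conditions $|a_{n}|>\sum_{i=0}^{n-1}|a_{i}|A^{i-n}$ and $|b_{0}|\geq\sum_{i=1}^{m}|b_{i}|B^{i}$ are replaced by $|a_{n}|\geq\sum_{i=0}^{n-1}|a_{i}|A^{i-n}$ and $|b_{0}|>\sum_{i=1}^{m}|b_{i}|B^{i}$ (all other hypotheses being kept), provided that the inequality on $|M|$ is strict, that is, $$|M|<|N|\cdot\frac{|b_{0}|-\sum_{i=1}^{m}|b_{i}|(A+q^{1/n}|N|)^{i}}{\sum_{i=0}^{n}|a_{i}|(A+q^{1/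n}|N|)^{i}}.$$
   Context: $Res(f,g)$ is the resultant of $f$ and $g$. *)

(* Defs.v *)
From mathcomp Require Import all_boot all_order all_algebra.
From mathcomp Require Import reals exp.

(* Main.v *)
Require Import Defs.
From mathcomp Require Import all_boot all_order all_algebra.
From mathcomp Require Import reals exp.
From mathcomp Require Import zify complex.

Set Implicit Arguments.
Unset Strict Implicit.
Unset Printing Implicit Defensive.

Import Order.TTheory GRing.Theory Num.Theory.
Local Open Scope ring_scope.

(** Write [h = M f + N g].  Over the complex numbers the resultant of [f] and
    [k] is, up to sign, [lc(f)^(deg k) * \prod k(theta)] over the roots [theta]
    of [f].  Since [h] takes the values of [N g] at these roots and has the
    degree of [g], [|Res(f, h)| = |N|^n |Res(f, g)| = p q |N|^n].  If
    [h = h1 h2] over the integers, then [Res(f, h1) Res(f, h2)] has this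
    absolute value too; the prime [p] divides one of the two factors, so the
    other one is at most [q |N|^n] in absolute value.

    On the other hand the roots of [f] and [h] are far apart.  The dominance of
    [a_n] confines the roots of [f] to the disc of radius [A], by comparing the
    leading term of [f] with the others.  A root [y] of [h] satisfies
    [|N| |g(y)| = |M| |f(y)|].  If [|y|] were smaller than
    [r = A + q^(1/n) |N|], then [|g(y)| >= |b_0| - sum_(i >= 1) |b_i| |y|^i]
    would be larger than [|b_0| - sum_(i >= 1) |b_i| r^i], and the bound on
    [|M|] would make [|N| |g(y)|] larger than
    [|M| sum_i |a_i| r^i >= |M| |f(y)|].  So every root of [h] is at distance
    more than [s = r - A = q^(1/n) |N| >= 1] from every root [theta] of [f].
    As leading coefficients are nonzero integers, for a factor [h1] of positive
    degree this gives [|h1(theta)| > s] ([norm_horner_gt]) and hence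
    [|Res(f, h1)| > s^n = q |N|^n] ([norm_resultant_gt]).  This holds for both
    factors, a contradiction ([irreducible_of_resultant]).  In the two variants
    of the hypotheses it is either [|theta| < A] and [|y| >= r], or
    [|theta| <= A] and [|y| > r], that yields a distance larger than [s].

    What is needed about resultants is Poisson's product formula.  It follows
    from [Res(f, g (X - x)) = f(x) Res(f, g)] ([sylvester_MXsubC]) by induction
    on the roots of the second argument; comparing with the product over all
    differences of roots gives the version over the roots of the first. *)

(** * The product formula for the resultant *)

Section PolyDet.
Variable R : comNzRingType.
Implicit Types (f g : {poly R}) (F G : nat -> {poly R}).

(** The rows are indexed by [nat] rather than by ['I_d], so that families of
    different lengths can be compared without casts between ordinal types. *)
Definition coef_det d F : R := \det (\matrix_(i < d, j < d) (F i)`_j).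

Lemma eq_coef_det d F G :
  (forall i, (i < d)%N -> F i = G i) -> coef_det d F = coef_det d G.
Proof.
by move=> eqFG; congr (\det _); apply/matrixP=> i j; rewrite !mxE eqFG.
Qed.

(** This is multiplication on the left by a lower unitriangular matrix; all rows
    change at once, each one by a multiple of the original preceding row. *)
Lemma coef_det_rowop d F (c : nat -> R) :
  coef_det d (fun i => if i is k.+1 then F i + c i *: F k else F i)
  = coef_det d F.
Proof.
pose U : 'M[R]_d :=
  \matrix_(i, j) ((i == j)%:R + c i *+ (i == j.+1 :> nat)).
have detU : \det U = 1.
  rewrite det_trig; last first.
    apply/is_trig_mxP=> i j lt_ij; rewrite mxE -val_eqE /=.
    by rewrite (ltn_eqF lt_ij) (ltn_eqF (leqW lt_ij)) mulr0n addr0.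
  by rewrite big1 // => i _; rewrite mxE eqxx (ltn_eqF (ltnSn i)) addr0.
rewrite -[RHS]mul1r -detU -det_mulmx; congr (\det _).
apply/matrixP=> i j; rewrite !mxE.
transitivity (\sum_(k < d) ((if i == k then (F k)`_j else 0)
      + (if i == k.+1 :> nat then c i * (F k)`_j else 0))).
  rewrite big_split /= -big_mkcond /=.
  rewrite (eq_bigl (pred1 i)) ?big_pred1_eq => [|k]; last by rewrite eq_sym.
  rewrite -big_mkcond /=; case: i => [[|i] lt_id] /=; first by rewrite big1 ?addr0.
  rewrite (big_pred1 (Ordinal (ltnW lt_id))) ?coefD ?coefZ //.
by apply: eq_bigr => k _; rewrite !mxE mulrDl mulr_natl mulrnAl !mulrb.
Qed.

(** Evaluation at [x] is a unimodular column operation that turns the first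
    column into [(f(x), 0, ..., 0)].  The remaining minor holds the nonconstant
    coefficients of the [F k * ('X - x)], which are obtained from those of the
    [F k] by a unitriangular column operation. *)
Lemma coef_det_MXsubC d f F (x : R) :
    (size f <= d.+1)%N -> (forall i, (i < d)%N -> (size (F i) <= d)%N) ->
  coef_det d.+1 (fun i => if i is k.+1 then F k * ('X - x%:P) else f)
  = f.[x] * coef_det d F.
Proof.
move=> sz_f sz_F; set G := fun i => _.
have sz_G i : (i < d.+1)%N -> (size (G i) <= d.+1)%N.
  case: i => [|i] //=; rewrite ltnS => lt_id.
  apply: leq_trans (size_polyMleq _ _) _.
  by rewrite size_XsubC addn2 /= ltnS sz_F.
(* [V] puts the values at [x] in the first column and keeps the others. *)
pose V : 'M[R]_d.+1 := \matrix_(i, j) (if j == ord0 then x ^+ i else (i == j)%:R).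
have detV : \det V = 1.
  rewrite det_trig; last first.
    apply/is_trig_mxP=> i j lt_ij; rewrite mxE -!val_eqE /= (ltn_eqF lt_ij).
    by rewrite gtn_eqF // (leq_ltn_trans _ lt_ij).
  rewrite big1 // => i _; rewrite mxE eqxx; case: eqP => // ->.
  by rewrite expr0.
(* [W] sends [(F i)`_j] to the coefficient [j.+1] of [F i * ('X - x)]. *)
pose W : 'M[R]_d := \matrix_(i, j) ((i == j)%:R - x *+ (i == j.+1 :> nat)).
have detW : \det W = 1.
  rewrite det_trig; last first.
    apply/is_trig_mxP=> i j lt_ij; rewrite mxE -val_eqE /=.
    by rewrite (ltn_eqF lt_ij) (ltn_eqF (leqW lt_ij)) subr0.
  by rewrite big1 // => i _; rewrite mxE eqxx (ltn_eqF (ltnSn i)) subr0.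
rewrite /coef_det -[LHS]mulr1 -{1}detV -det_mulmx.
set A := _ *m V.
have A0 i : A i ord0 = (G i).[x].
  rewrite (horner_coef_wide _ (sz_G _ (ltn_ord i))) mxE.
  by apply: eq_bigr => j _; rewrite !mxE.
have A1 i (j : 'I_d) : A i (lift ord0 j) = (G i)`_j.+1.
  rewrite mxE (bigD1 (lift ord0 j)) //= big1 ?addr0 => [|k ne_kj].
    by rewrite !mxE eqxx /= mulr1.
  by rewrite !mxE /= (negPf ne_kj) mulr0.
rewrite (expand_det_col _ ord0) big_ord_recl big1 ?addr0 => [|i _]; last first.
  by rewrite A0 /= hornerM hornerXsubC subrr mulr0 mul0r.
rewrite A0 /=; congr (_ * _).
rewrite /cofactor /= expr0 mul1r -[RHS]mulr1 -{1}detW -det_mulmx.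
congr (\det _); apply/matrixP=> i j; rewrite 2!mxE A1 /=.
rewrite mulrBr coefB coefMX coefMC /= mxE.
transitivity (\sum_(k < d) ((if k == j then (F i)`_k else 0)
      - (if k == j.+1 :> nat then (F i)`_k * x else 0))).
  rewrite sumrB -big_mkcond /= big_pred1_eq; congr (_ - _).
  rewrite -big_mkcond /=; case: (ltnP j.+1 d) => [ltjd | ledj].
    by rewrite (big_pred1 (Ordinal ltjd)) // => k.
  rewrite nth_default ?(leq_trans (sz_F _ (ltn_ord i))) // mul0r big1 // => k /eqP kj.
  by have := ltn_ord k; rewrite kj ltnNge ledj.
by apply: eq_bigr => k _; rewrite !mxE mulrBr mulr_natr mulrnAr !mulrb.
Qed.

Definition sylvester m f g i : {poly R} :=
  if (i < m)%N then f * 'X^i else g * 'X^(i - m).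

Lemma resultant_coef_det f g :
  resultant f g
  = coef_det ((size g).-1 + (size f).-1) (sylvester (size g).-1 f g).
Proof.
congr (\det _); apply/matrixP=> i j; rewrite Sylvester_mxE mxE /sylvester.
by case: split_ordP => k -> /=; rewrite ?ltn_ord ?ltnNge ?leq_addr ?addKn /=
  coefMXn ltnNge; case: leqP.
Qed.

(** Subtracting [x] times the preceding row from each shift of [f] but the first
    leaves [f] on top of [('X - x)] times the Sylvester rows of [f] and [g]. *)
Lemma sylvester_MXsubC m n f g (x : R) :
    (size f <= n.+1)%N -> (size g <= m.+1)%N ->
  coef_det (m.+1 + n) (sylvester m.+1 f (g * ('X - x%:P)))
  = f.[x] * coef_det (m + n) (sylvester m f g).
Proof.
move=> sz_f sz_g; rewrite -coef_det_MXsubC; first 1 last.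
- by rewrite (leq_trans sz_f) // ltnS leq_addl.
- move=> i lt_i; rewrite /sylvester; case: ltnP => [lt_im | le_mi];
    apply: leq_trans (size_polyMleq _ _) _; rewrite size_polyXn addnS /=.
    by move: (size f) sz_f lt_im => s; lia.
  by move: (size g) sz_g lt_i le_mi => s; lia.
rewrite -(@coef_det_rowop _ (sylvester _ _ _)
  (fun i => if (i <= m)%N then - x else 0)).
apply: eq_coef_det => -[|i] lt_i /=.
  by rewrite /sylvester /= expr0 mulr1.
rewrite /sylvester ltnS; case: (ltnP i m) => [lt_im|le_mi].
  rewrite (leqW lt_im) exprS mulrBr scaleNr; congr (_ - _).
    by rewrite -mulrA (mulrC 'X).
  by rewrite -mul_polyC [RHS]mulrC.
by rewrite scale0r addr0 subSS mulrAC.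
Qed.

Lemma coef_det_sylvester_prod n f (c : R) (rs : seq R) :
    (size f <= n.+1)%N ->
  coef_det (size rs + n)
    (sylvester (size rs) f (c *: \prod_(z <- rs) ('X - z%:P)))
  = c ^+ n * \prod_(z <- rs) f.[z].
Proof.
move=> sz_f; elim: rs => [|z rs IHrs].
  rewrite !big_nil mulr1 /coef_det /sylvester /= add0n -det_scalar.
  congr (\det _); apply/matrixP=> i j.
  by rewrite !mxE subn0 -scalerAl mul1r coefZ coefXn mulr_natr eq_sym.
rewrite /= !big_cons mulrC scalerAl sylvester_MXsubC // ?IHrs.
  by rewrite mulrCA.
by rewrite (leq_trans (size_scale_leq _ _)) // size_prod_XsubC.
Qed.

End PolyDet.

Lemma resultant_prod_XsubC (R : idomainType) (f : {poly R}) (c : R)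
    (rs : seq R) : c != 0 ->
  resultant f (c *: \prod_(z <- rs) ('X - z%:P))
  = c ^+ (size f).-1 * \prod_(z <- rs) f.[z].
Proof.
move=> c_neq0; rewrite resultant_coef_det size_scale // size_prod_XsubC /=.
by rewrite coef_det_sylvester_prod // leqSpred.
Qed.

Lemma resultantMr (F : closedFieldType) (f g1 g2 : {poly F}) : g1 != 0 -> g2 != 0 ->
  resultant f (g1 * g2) = resultant f g1 * resultant f g2.
Proof.
rewrite -!lead_coef_eq0; have [r1 ->] := closed_field_poly_normal g1.
have [r2 ->] := closed_field_poly_normal g2.
have mon r : lead_coef (\prod_(z <- r) ('X - z%:P)) = 1 :> F.
  exact/eqP/monic_prod_XsubC.
rewrite !lead_coefZ !mon !mulr1 => c1 c2.
rewrite -scalerAl -scalerAr scalerA -big_cat !resultant_prod_XsubC ?mulf_neq0 //.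
by rewrite big_cat exprMn mulrACA.
Qed.

(** Both sides equal [|a|^(deg g) |c|^(deg f)] times the product of all distances
    between a root of [f] and a root of [g], where [c] is the leading
    coefficient of [g]. *)
Lemma norm_resultant_prod_XsubC (C : numClosedFieldType) (a : C) (rs : seq C)
    (g : {poly C}) : a != 0 -> g != 0 ->
  `|resultant (a *: \prod_(z <- rs) ('X - z%:P)) g|
  = `|a| ^+ (size g).-1 * \prod_(z <- rs) `|g.[z]|.
Proof.
rewrite -(lead_coef_eq0 g); have [ss ->] := closed_field_poly_normal g.
set c := lead_coef g; set P := \prod_(z <- ss) _.
rewrite lead_coefZ (eqP (monic_prod_XsubC _ _ _)) mulr1 => a0 c0.
rewrite resultant_prod_XsubC // !size_scale // !size_prod_XsubC /= normrM normrX.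
rewrite normr_prod.
have hornerP (b : C) (us : seq C) x :
   `|(b *: \prod_(z <- us) ('X - z%:P)).[x]| = `|b| * \prod_(z <- us) `|x - z|.
  rewrite hornerZ horner_prod normrM normr_prod; congr (_ * _).
  by apply: eq_bigr => z _; rewrite hornerXsubC.
under eq_bigr do rewrite hornerP.
under [in RHS]eq_bigr do rewrite hornerP.
rewrite !big_split /= !big_const_seq !count_predT !iter_mulr_1.
rewrite exchange_big mulrCA; congr (_ * (_ * _)).
by apply: eq_bigr => z _; apply: eq_bigr => t _; rewrite distrC.
Qed.

(** * Resultants of integer polynomials *)

Lemma resultant_map (aR rR : comNzRingType) (phi : {rmorphism aR -> rR})
    (f g : {poly aR}) : injective phi ->
  phi (resultant f g) = resultant (map_poly phi f) (map_poly phi g).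
Proof.
move=> phi_inj; have sz (u : {poly aR}) : size (map_poly phi u) = size u.
  by apply: size_map_inj_poly => //; rewrite rmorph0.
rewrite !resultant_coef_det !sz -det_map_mx; congr (\det _).
apply/matrixP=> i j; rewrite !mxE /sylvester; case: ifP => _;
by rewrite -coef_map rmorphM /= map_polyXn.
Qed.

Section NumClosed.
Variable C : numClosedFieldType.
Implicit Types f g k : {poly C}.

(** The value of [M *: f + N *: g] at a root of [f] is that of [N *: g], and its
    degree is that of [g]. *)
Lemma norm_resultantDZ f g (M N : C) :
    f != 0 -> (size f < size g)%N -> N != 0 ->
  `|resultant f (M *: f + N *: g)| = `|N| ^+ (size f).-1 * `|resultant f g|.
Proof.
move=> f0 lt_fg N0.
have sz_g : size (M *: f + N *: g) = size g.
  rewrite addrC size_polyDl (size_scale g N0) //.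
  exact: leq_ltn_trans (size_scale_leq _ _) lt_fg.
have g0 : g != 0 by rewrite -size_poly_gt0 (leq_ltn_trans _ lt_fg).
have h0 : M *: f + N *: g != 0 by rewrite -size_poly_eq0 sz_g size_poly_eq0.
have [rs Df] := closed_field_poly_normal f.
rewrite {1 4}Df !norm_resultant_prod_XsubC ?lead_coef_eq0 // sz_g.
rewrite Df size_scale ?lead_coef_eq0 // size_prod_XsubC /= -Df mulrCA.
congr (_ * _); transitivity (\prod_(z <- rs) (`|N| * `|g.[z]|)).
  apply: eq_big_seq => z rs_z; rewrite hornerD !hornerZ -normrM.
  suff /rootP-> : root f z by rewrite mulr0 add0r.
  by rewrite Df rootZ ?lead_coef_eq0 // root_prod_XsubC.
by rewrite big_split big_const_seq count_predT iter_mulr_1.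
Qed.

(** In the factorization of [k.[x]] over the roots of [k], one difference exceeds
    [s] and the other factors are at least 1 in absolute value. *)
Lemma norm_horner_gt k (x s : C) :
    (1 < size k)%N -> 1 <= `|lead_coef k| -> 1 <= s ->
    (forall y, root k y -> s < `|x - y|) ->
  s < `|k.[x]|.
Proof.
move=> k_gt1 lc_k s_ge1; have [rs Dk] := closed_field_poly_normal k.
have k0 : lead_coef k != 0 by rewrite lead_coef_eq0 -size_poly_gt0 ltnW.
move=> sep; rewrite Dk hornerZ normrM horner_prod normr_prod.
have {}sep y : y \in rs -> s < `|x - y|.
  by move=> rs_y; apply: sep; rewrite Dk rootZ // root_prod_XsubC.
apply: (@lt_le_trans _ _ (\prod_(z <- rs) `|('X - z%:P).[x]|)); last first.
  by rewrite ler_peMl // prodr_ge0.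
have: (0 < size rs)%N.
  by move: k_gt1; rewrite Dk size_scale // size_prod_XsubC.
case: rs {Dk} sep => [//|z rs] sep _; rewrite big_cons hornerXsubC.
apply: lt_le_trans (sep _ (mem_head _ _)) _; rewrite ler_peMr //.
rewrite big_seq; elim/big_ind: _ => //= [u v u1 v1|y rs_y].
  by rewrite -[1]mulr1 ler_pM.
by rewrite hornerXsubC ltW // (le_lt_trans s_ge1) // sep // inE rs_y orbT.
Qed.

Lemma norm_resultant_gt f k (s : C) :
    (1 < size f)%N -> (1 < size k)%N ->
    1 <= `|lead_coef f| -> 1 <= `|lead_coef k| -> 1 <= s ->
    (forall x y, root f x -> root k y -> s < `|x - y|) ->
  s ^+ (size f).-1 < `|resultant f k|.
Proof.
move=> f_gt1 k_gt1 lc_f lc_k s_ge1 sep; have [rs Df] := closed_field_poly_normal f.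
have f0 : lead_coef f != 0 by rewrite lead_coef_eq0 -size_poly_gt0 ltnW.
have k0 : k != 0 by rewrite -size_poly_gt0 ltnW.
have sz_f : (size f).-1 = size rs by rewrite Df size_scale // size_prod_XsubC.
rewrite sz_f Df norm_resultant_prod_XsubC //.
apply: (@lt_le_trans _ _ (\prod_(z <- rs) `|k.[z]|)); last first.
  by rewrite ler_peMl ?prodr_ge0 // exprn_ege1.
rewrite -(count_predT rs) -iter_mulr_1 -big_const_seq big_seq [ltRHS]big_seq.
apply: ltr_prod => [|z rs_z].
  have: (0 < size rs)%N by rewrite -sz_f -ltnS prednK // ltnW.
  by case: (rs) => [|z ss] //= _; rewrite inE eqxx.
rewrite (le_trans ler01) //= norm_horner_gt // => y; apply: sep.
by rewrite Df rootZ // root_prod_XsubC.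
Qed.

End NumClosed.

Section IntResultant.
Variable C : numClosedFieldType.
Local Notation toC := (map_poly (intr : int -> C)).

Let toC_inj : injective (intr : int -> C). Proof. exact: intr_inj. Qed.

Let size_toC (f : {poly int}) : size (toC f) = size f.
Proof. exact: size_map_inj_poly. Qed.

Let toC_neq0 (f : {poly int}) : (toC f != 0) = (f != 0).
Proof. by rewrite -!size_poly_eq0 size_toC. Qed.

(** In a factorization of [h] into nonconstant integer polynomials, both factors
    have a resultant with [f] of absolute value more than [Q]; but [p] divides
    one of these resultants, whence the other is at most [Q].  Gauss's lemma
    makes it enough to consider integer factors. *)
Lemma irreducible_of_resultant (f h : {poly int}) (p Q : nat) (s : C) :
    (1 < size f)%N -> (1 < size h)%N -> prime p -> (0 < Q)%N ->
    `|resultant f h|%N = (p * Q)%N -> 1 <= s -> Q%:R <= s ^+ (size f).-1 ->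
    (forall x y, root (toC f) x -> root (toC h) y -> s < `|x - y|) ->
  irreducible_poly (map_poly (intr : int -> rat) h).
Proof.
move=> f_gt1 h_gt1 p_pr Q_gt0 Rfh s_ge1 Qs sep.
have lc1 (u : {poly int}) : u != 0 -> 1 <= `|lead_coef (toC u)|.
  move=> u0; rewrite lead_coef_map_inj // -intr_norm ler1z -gtz0_ge1.
  by rewrite normr_gt0 lead_coef_eq0.
have f0 : f != 0 by rewrite -size_poly_gt0 ltnW.
have factor_gt (k e : {poly int}) : (1 < size k)%N -> h = k * e ->
  (Q < `|resultant f k|)%N.
  move=> k_gt1 Dh; have k0 : k != 0 by rewrite -size_poly_gt0 ltnW.
  rewrite -(ltr_nat C) (le_lt_trans Qs) // pmulrn.
  rewrite abszE intr_norm (resultant_map _ _ toC_inj) -(size_toC f).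
  apply: norm_resultant_gt; rewrite ?size_toC ?lc1 // => x y fx ky.
  by apply: sep => //; rewrite Dh rmorphM rootM ky.
split=> [|d sz_d d_h]; first by rewrite size_rat_int_poly.
have [d1 [a a0 Dd] [e Dh]] := dvdpP_rat_int d_h.
have h0 : h != 0 by rewrite -size_poly_gt0 ltnW.
have /andP[d10 e0] : (d1 != 0) && (e != 0) by rewrite -negb_or -mulf_eq0 -Dh.
have d1_gt1 : (1 < size d1)%N.
  move: sz_d; rewrite Dd size_scale // size_rat_int_poly.
  by have := size_poly_gt0 d1; rewrite d10; case: (size d1) => [|[]].
have [e_gt1|e_le1] := ltnP 1 (size e).
  have := factor_gt _ _ d1_gt1 Dh.
  have := factor_gt _ d1 e_gt1 (etrans Dh (mulrC _ _)).
  move: Rfh; have := resultantMr (toC f) (g1 := toC d1) (g2 := toC e).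
  rewrite !toC_neq0 => /(_ d10 e0).
  rewrite -rmorphM -Dh -!(resultant_map _ _ toC_inj) -intrM => /toC_inj ->.
  rewrite abszM; set u := absz _; set v := absz _ => Duv ltQv ltQu.
  have p_gt0 := prime_gt0 p_pr.
  have le_cofactor w x : (w * p * x = p * Q -> x <= Q)%N.
    rewrite -mulnA mulnCA => /eqP; rewrite eqn_pmul2l // => /eqP DQ.
    by move: Q_gt0; rewrite -DQ muln_gt0 => /andP[w_gt0 _]; apply: leq_pmull.
  have: (p %| u * v)%N by rewrite Duv dvdn_mulr.
  rewrite Euclid_dvdM // => /orP[] /dvdnP[w Dw]; move: Duv; rewrite Dw.
    by move/le_cofactor; rewrite leqNgt ltQv.
  by rewrite mulnC => /le_cofactor; rewrite leqNgt ltQu.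
have [c De] : exists c, e = c%:P by exists e`_0; apply: size1_polyC.
have c0 : c != 0 by rewrite -polyC_eq0 -De.
rewrite Dd Dh De rmorphM /= map_polyC /= mulrC mul_polyC.
rewrite (eqp_trans (eqp_scale _ a0)) // eqp_sym eqp_scale // intr_eq0 //.
Qed.

End IntResultant.

(** * Bounds on roots in terms of coefficients *)

Section NormHorner.
Variable K : numDomainType.
Implicit Types (p : {poly K}) (x : K).

Lemma norm_horner_le p n x : (size p <= n)%N ->
  `|p.[x]| <= \sum_(0 <= i < n) `|p`_i| * `|x| ^+ i.
Proof.
move=> sz_p; rewrite (horner_coef_wide _ sz_p) big_mkord.
apply: le_trans (ler_norm_sum _ _ _) _.
by apply: ler_sum => i _; rewrite normrM normrX.
Qed.

Lemma norm_coef0_le p n x : (size p <= n.+1)%N ->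
  `|p`_0| <= `|p.[x]| + \sum_(1 <= i < n.+1) `|p`_i| * `|x| ^+ i.
Proof.
move=> sz_p; rewrite (horner_coef_wide _ sz_p).
rewrite -(big_mkord xpredT (fun i => p`_i * x ^+ i)) big_ltn // expr0 mulr1.
rewrite -[X in `|X| <= _](addrK (\sum_(1 <= i < n.+1) p`_i * x ^+ i)).
apply: le_trans (ler_normB _ _) _; rewrite lerD2l.
apply: le_trans (ler_norm_sum _ _ _) _.
by apply: ler_sum => i _; rewrite normrM normrX.
Qed.

Lemma root_lead_le p n x : (size p <= n.+1)%N -> root p x ->
  `|p`_n| * `|x| ^+ n <= \sum_(0 <= i < n) `|p`_i| * `|x| ^+ i.
Proof.
move=> sz_p /rootP; rewrite (horner_coef_wide _ sz_p) big_ord_recr /=.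
rewrite addrC => /eqP; rewrite addr_eq0 => /eqP px.
rewrite -normrX -normrM px normrN big_mkord.
apply: le_trans (ler_norm_sum _ _ _) _.
by apply: ler_sum => i _; rewrite normrM normrX.
Qed.

End NormHorner.

Section RealSums.
Variable R : realFieldType.
Variable c : nat -> R.
Hypothesis c_ge0 : forall i, 0 <= c i.

Lemma ler_sum_pow k n (t r : R) : 0 <= t -> t <= r ->
  \sum_(k <= i < n) c i * t ^+ i <= \sum_(k <= i < n) c i * r ^+ i.
Proof.
move=> t_ge0 le_tr; apply: ler_sum_nat => i _.
by rewrite ler_wpM2l // lerXn2r // nnegrE ?(le_trans t_ge0).
Qed.

Lemma ltr_sum_pow n (t r : R) : (0 < n)%N -> 0 < c n -> 0 <= t -> t < r ->
  \sum_(1 <= i < n.+1) c i * t ^+ i < \sum_(1 <= i < n.+1) c i * r ^+ i.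
Proof.
move=> n_gt0 cn t_ge0 lt_tr; rewrite !big_nat_recr //=.
apply: ler_ltD; first exact: ler_sum_pow (ltW lt_tr).
by rewrite ltr_pM2l // ltrXn2r -?lt0n ?nnegrE // (le_trans t_ge0) // ltW.
Qed.

Lemma lead_le_inv n (t : R) : 0 < t ->
  c n * t ^+ n <= \sum_(0 <= i < n) c i * t ^+ i ->
  c n <= \sum_(0 <= i < n) c i * t^-1 ^+ (n - i).
Proof.
move=> t_gt0 ct; rewrite -(ler_pM2r (exprn_gt0 n t_gt0)).
apply: le_trans ct _.
rewrite mulr_suml ler_sum_nat // => i /andP[_ lt_in].
rewrite -mulrA ler_wpM2l // exprVn -[in t ^+ n](subnK (ltnW lt_in)) exprD.
by rewrite mulKf // expf_neq0 // gt_eqF.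
Qed.

Lemma sum_exprzE n (A : R) : \sum_(0 <= i < n) c i * A ^ (i%:Z - n%:Z)
  = \sum_(0 <= i < n) c i * A^-1 ^+ (n - i).
Proof.
apply: eq_big_nat => i /andP[_ lt_in]; congr (_ * _).
by rewrite -opprB -exprz_inv subzn // ltnW.
Qed.

(** After division by [t ^+ n] the bound on the leading term is a nonincreasing
    function of [t]; this and the next lemma compare its values at [t] and at
    [A]. *)
Lemma lead_le_lt n (A t : R) : 0 < A ->
    c n * t ^+ n <= \sum_(0 <= i < n) c i * t ^+ i ->
    \sum_(0 <= i < n) c i * A ^ (i%:Z - n%:Z) < c n ->
  t < A.
Proof.
move=> A_gt0 ct cA; rewrite ltNge; apply/negP => le_At.
have t_gt0 := lt_le_trans A_gt0 le_At.
move: cA; rewrite sum_exprzE ltNge => /negP; apply.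
apply: le_trans (lead_le_inv t_gt0 ct) _; apply: ler_sum_nat => i _.
by rewrite ler_wpM2l // lerXn2r ?nnegrE ?invr_ge0 ?lef_pV2 // ltW.
Qed.

(** Strictness comes from the term of index 0, a positive multiple of a
    negative power of [t]. *)
Lemma lead_le_le n (A t : R) : (0 < n)%N -> 0 < c 0%N -> 0 < A ->
    c n * t ^+ n <= \sum_(0 <= i < n) c i * t ^+ i ->
    \sum_(0 <= i < n) c i * A ^ (i%:Z - n%:Z) <= c n ->
  t <= A.
Proof.
move=> n_gt0 c0 A_gt0 ct cA; rewrite leNgt; apply/negP => lt_At.
have t_gt0 := lt_trans A_gt0 lt_At.
move: cA; rewrite sum_exprzE leNgt => /negP; apply.
apply: le_lt_trans (lead_le_inv t_gt0 ct) _; rewrite !(big_ltn n_gt0) ltr_leD //.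
  by rewrite ltr_pM2l // subn0 ltrXn2r ?lt0n ?nnegrE ?invr_ge0 ?ltf_pV2 -?lt0n ?ltW.
apply: ler_sum_nat => i _.
by rewrite ler_wpM2l // lerXn2r ?nnegrE ?invr_ge0 ?lef_pV2 // ltW.
Qed.

End RealSums.

Section IntPolyAtComplex.
Variable R : rcfType.
Implicit Types (f g h : {poly int}) (x y : R[i]).
Local Notation toC := (map_poly (intr : int -> R[i])).
Local Notation abs := (@ComplexField.Normc.normc R : R[i] -> R).

Lemma norm_toC_sum h k n x :
  \sum_(k <= i < n) `|(toC h)`_i| * `|x| ^+ i
  = real_complex R (\sum_(k <= i < n) `|h`_i|%:~R * abs x ^+ i).
Proof.
rewrite rmorph_sum; apply: eq_bigr => i _.
by rewrite rmorphM rmorphXn /= rmorph_int coef_map /= intr_norm.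
Qed.

Lemma abs_root_lead_le f n x : (size f <= n.+1)%N -> root (toC f) x ->
  `|f`_n|%:~R * abs x ^+ n <= \sum_(0 <= i < n) `|f`_i|%:~R * abs x ^+ i.
Proof.
move=> sz_f fx; rewrite -lecR -norm_toC_sum rmorphM rmorphXn /= rmorph_int.
rewrite intr_norm -coef_map; apply: root_lead_le fx.
exact: leq_trans (size_poly _ _) sz_f.
Qed.

(** At a root [y] of [M *: f + N *: g] one has [|N| |g(y)| = |M| |f(y)|]. *)
Lemma abs_root_comb_le f g (M N : int) n m y :
    (size f <= n.+1)%N -> (size g <= m.+1)%N ->
    root (toC (M *: f + N *: g)) y ->
  `|N|%:~R * `|g`_0|%:~R <=
     `|M|%:~R * (\sum_(0 <= i < n.+1) `|f`_i|%:~R * abs y ^+ i)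
   + `|N|%:~R * (\sum_(1 <= i < m.+1) `|g`_i|%:~R * abs y ^+ i).
Proof.
move=> sz_f sz_g /rootP.
rewrite rmorphD /= !map_polyZ hornerD !hornerZ addrC => /eqP.
rewrite addr_eq0 => /eqP eqNg.
have sz_toC (h : {poly int}) d : (size h <= d)%N -> (size (toC h) <= d)%N.
  exact: leq_trans (size_poly _ _).
rewrite -lecR rmorphD !rmorphM /= !rmorph_int -!norm_toC_sum.
apply: (@le_trans _ _ (`|N|%:~R * (`|(toC g).[y]|
  + \sum_(1 <= i < m.+1) `|(toC g)`_i| * `|y| ^+ i))).
  rewrite ler_wpM2l ?ler0z ?normr_ge0 // intr_norm -coef_map.
  exact/norm_coef0_le/sz_toC.
rewrite mulrDr lerD2r intr_norm -normrM eqNg normrN normrM intr_norm.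
by rewrite ler_wpM2l // norm_horner_le // sz_toC.
Qed.

End IntPolyAtComplex.

(** * Irreducibility of linear combinations *)

Theorem theorem6p1 (R : realType) (n m : nat) (a b : nat -> int)
    (p q : nat) (A B : R) (M N : int) :
  let f : {poly int} := \poly_(i < n.+1) a i in
  let g : {poly int} := \poly_(i < m.+1) b i in
  let qn : R := q%:R `^ (n%:R^-1) in
  let r : R := A + qn * `|N|%:~R in
  let bound : R :=
    `|N|%:~R * ((`|b 0%N|%:~R - \sum_(1 <= i < m.+1) `|b i|%:~R * r ^+ i)
                / \sum_(0 <= i < n.+1) `|a i|%:~R * r ^+ i) in
  let sumA : R := \sum_(0 <= i < n) `|a i|%:~R * A ^ (i%:Z - n%:Z) in
  let sumB : R := \sum_(1 <= i < m.+1) `|b i|%:~R * B ^+ i in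
  (1 <= n)%N -> (n < m)%N ->
  a 0%N * a n * b 0%N * b m != 0 ->
  prime p -> (0 < q)%N ->
  `|resultant f g| = p%:Z * q%:Z ->
  0 < A -> 0 < B -> A + qn <= B ->
  ~ (M = 0 /\ N = 0) ->
  `|N|%:~R <= (B - A) / qn ->
  (sumA < `|a n|%:~R -> sumB <= `|b 0%N|%:~R -> `|M|%:~R <= bound ->
     irreducible_poly (map_poly (intr : int -> rat) (M *: f + N *: g)))
  /\
  (sumA <= `|a n|%:~R -> sumB < `|b 0%N|%:~R -> `|M|%:~R < bound ->
     irreducible_poly (map_poly (intr : int -> rat) (M *: f + N *: g))).
Proof.
move=> f g qn r bound sumA sumB n_gt0 lt_nm.
rewrite !mulf_eq0 !negb_or -!andbA => /and4P[a0 an b0 bm] p_pr q_gt0 Rfg.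
move=> A_gt0 _ _ MN0 _.
have sz_f : size f = n.+1 by rewrite size_poly_eq.
have sz_g : size g = m.+1 by rewrite size_poly_eq.
have m_gt0 : (0 < m)%N by apply: leq_trans lt_nm.
have qn_ge0 : 0 <= qn := powR_ge0 _ _.
have qnX : qn ^+ n = q%:R.
  by rewrite -powR_mulrn // -powRrM mulVf ?pnatr_eq0 -?lt0n // powRr1.
have qn_ge1 : 1 <= qn by rewrite -(expr_ge1 n_gt0) // qnX ler1n.
have r_gt0 : 0 < r by rewrite ltr_pwDl // mulr_ge0 // ler0z.
pose cA i : R := `|a i|%:~R; pose cB i : R := `|b i|%:~R.
have cA_ge0 i : 0 <= cA i by rewrite ler0z.
have cB_ge0 i : 0 <= cB i by rewrite ler0z.
have cA0 : 0 < cA 0%N by rewrite ltr0z normr_gt0.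
have cBm : 0 < cB m by rewrite ltr0z normr_gt0.
pose SA t : R := \sum_(0 <= i < n.+1) cA i * t ^+ i.
pose SB t : R := \sum_(1 <= i < m.+1) cB i * t ^+ i.
have SAr_gt0 : 0 < SA r.
  rewrite /SA big_ltn // expr0 mulr1 ltr_wpDr // sumr_ge0 // => i _.
  by rewrite mulr_ge0 // exprn_ge0 // ltW.
have coef_f i : (i < n.+1)%N -> f`_i = a i by move=> lt_i; rewrite coef_poly lt_i.
have coef_g i : (i < m.+1)%N -> g`_i = b i by move=> lt_i; rewrite coef_poly lt_i.
(* For [N = 0] the bound on [M] is 0. *)
have N_neq0 : `|M|%:~R <= bound -> N != 0.
  move=> leM; apply/eqP => N0; apply: MN0; split=> //; move: leM.
  by rewrite /bound N0 normr0 mul0r lerz0 normr_le0 => /eqP.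
set C := R[i]; pose toC := map_poly (intr : int -> C).
pose abs := @ComplexField.Normc.normc R : C -> R.
set h := M *: f + N *: g.
have rootf x : root (toC f) x ->
    cA n * abs x ^+ n <= \sum_(0 <= i < n) cA i * abs x ^+ i.
  move/(abs_root_lead_le (n := n)); rewrite sz_f coef_f //.
  move=> /(_ (leqnn _)) /le_trans-> //.
  rewrite le_eqVlt; apply/orP; left; apply/eqP/eq_big_nat => i /andP[_ lt_in].
  by rewrite coef_f // ltnW.
have rooth y : root (toC h) y ->
    `|N|%:~R * cB 0%N <= `|M|%:~R * SA (abs y) + `|N|%:~R * SB (abs y).
  move/(abs_root_comb_le (n := n) (m := m)); rewrite sz_f sz_g coef_g //.
  move=> /(_ (leqnn _) (leqnn _)) /le_trans-> //.
  rewrite le_eqVlt; apply/orP; left; apply/eqP.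
  congr (_ * _ + _ * _); apply: eq_big_nat => i /andP[_ lt_i].
    by rewrite coef_f.
  by rewrite coef_g.
have irr : `|M|%:~R <= bound ->
    (forall x y, root (toC f) x -> root (toC h) y -> r - A < abs y - abs x) ->
    irreducible_poly (map_poly (intr : int -> rat) h).
  move=> /N_neq0 N0 sep.
  have lt_sz : (size f < size g)%N by rewrite sz_f sz_g.
  have sz_h : size h = size g.
    rewrite /h addrC size_polyDl (size_scale g N0) //.
    exact: leq_ltn_trans (size_scale_leq _ _) lt_sz.
  have N_ge1 : 1 <= `|N|%:~R :> R by rewrite ler1z -gtz0_ge1 normr_gt0.
  apply: (@irreducible_of_resultant _ f h p (q * `|N| ^ n)
    (real_complex R (r - A))) => //.
  - by rewrite sz_f.
  - by rewrite sz_h sz_g ltnS.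
  - by rewrite muln_gt0 q_gt0 expn_gt0 absz_gt0 N0.
  - have injC : injective (intr : int -> C) by exact: intr_inj.
    apply/eqP; rewrite -eqz_nat abszE; apply/eqP/injC.
    rewrite intr_norm (resultant_map _ _ injC) rmorphD /= !map_polyZ.
    have size_toC u : size (map_poly (intr : int -> C) u) = size u.
      exact: size_map_inj_poly.
    rewrite norm_resultantDZ ?size_toC //; last first.
    + by rewrite intr_eq0.
    + by rewrite -size_poly_eq0 size_toC sz_f.
    rewrite -(resultant_map _ _ injC) -!intr_norm Rfg sz_f /=.
    rewrite -rmorphXn -rmorphM /=; congr (_%:~R).
    by rewrite !PoszM -abszE -rmorphXn /= mulrC mulrA.
  - rewrite -(rmorph1 (real_complex R)) lecR /r addrAC subrr add0r.
    exact: mulr_ege1.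
  - rewrite sz_f -rmorphXn /= /r addrAC subrr add0r exprMn qnX.
    rewrite -(rmorph_nat (real_complex R)) lecR natrM natrX.
    by rewrite natr_absz.
  - move=> x y fx hy; apply: lt_le_trans (_ : `|y| - `|x| <= _); last first.
      by rewrite distrC lerB_dist.
    have -> : `|y| - `|x| = real_complex R (abs y - abs x) by rewrite rmorphB.
    by rewrite ltcR sep.
have boundE : bound * SA r = `|N|%:~R * (cB 0%N - SB r).
  by rewrite /bound mulrA divfK // gt_eqF.
have ge0abs x : 0 <= abs x; first by rewrite -ler0c; exact: (normr_ge0 x).
have N_gt0 : `|M|%:~R <= bound -> 0 < `|N|%:~R :> R.
  by move/N_neq0 => N0; rewrite ltr0z normr_gt0.
have M_ge0 : 0 <= `|M|%:~R :> R by rewrite ler0z.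
split=> [ltA _ leM | leA _ ltM].
  apply: irr => // x y fx hy.
  have lt_xA : abs x < A := lead_le_lt cA_ge0 A_gt0 (rootf _ fx) ltA.
  suff le_ry : r <= abs y by rewrite ler_ltB.
  (* Both sums increase with the modulus, and the second one strictly because
     [b m != 0]; at [r] the bound on [M] makes their combination at most
     [|N| |b 0|]. *)
  rewrite leNgt; apply/negP => lt_yr.
  have := rooth _ hy; rewrite leNgt => /negP; apply.
  apply: (@lt_le_trans _ _ (bound * SA r + `|N|%:~R * SB r)).
    apply: ler_ltD; last by rewrite ltr_pM2l ?N_gt0 // ltr_sum_pow.
    apply: ler_pM => //; last exact: ler_sum_pow (ltW lt_yr).
    by rewrite sumr_ge0 // => i _; rewrite mulr_ge0 // exprn_ge0.
  by rewrite boundE -mulrDr subrK.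
have leM := ltW ltM.
apply: irr => // x y fx hy.
have le_xA : abs x <= A := lead_le_le cA_ge0 n_gt0 cA0 A_gt0 (rootf _ fx) leA.
suff lt_ry : r < abs y by rewrite ltr_leB.
(* Here the strictness comes from the bound on [M]. *)
rewrite ltNge; apply/negP => le_yr.
have := rooth _ hy; rewrite leNgt => /negP; apply.
apply: (@lt_le_trans _ _ (bound * SA r + `|N|%:~R * SB r)).
  apply: ltr_leD; last by apply/ler_wpM2l/ler_sum_pow => //; apply/ltW/N_gt0.
  apply: (@le_lt_trans _ _ (`|M|%:~R * SA r)); last by rewrite ltr_pM2r.
  by apply/ler_wpM2l/ler_sum_pow.
by rewrite boundE -mulrDr subrK.
Qed.
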